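(* Let $\Gamma=(\mathcal{V},\mathcal{E},\lambda)$ be a labeled graph with labels $\lambda(v)\in R^*$. Then for every bilinear form $g$ on the $\mathbb{F}_2$-vector space $V=V_\Gamma$ with $g(v,w)+g(w,v)=f_\Gamma(v,w)$ for all $v,w\in\mathcal{V}$, the $R$-algebra $\mathfrak{C}(\Gamma)$ is isomorphic to the $R$-algebra $\mathfrak{C}(V,g,\lambda)$.
   Context: $R$ is a commutative associative ring with identity $1$ in which $1\neq -1$ and $2$ is not a zero divisor; $R^*$ is its set of invertible elements. A labeled graph $\Gamma=(\mathcal{V},\mathcal{E},\lambda)$ is a simple undirected graph (possibly infinite) with vertex set $\mathcal{V}$, edge set $\mathcal{E}$ and a map $\lambda:\mathcal{V}\to R^*$; $v\sim w$ means $\{v,w\}\in\mathcal{E}$. $\mathfrak{C}(\Gamma)$ is the associative $R$-algebra with identity $\mathbf{1}$ generated by the elements of $\mathcal{V}$ subject to the relations, for $v,w\in\mathcal{V}$: $v^2=\lambda(v)\mathbf{1}$; $vw+wv=0$ if $v\sim w$; $vw-wv=0$ if $v\not\sim w$. $V_\Gamma$ is the $\mathbb{F}_2$-vector space with basis $\mathcal{V}$, with addition written $\oplus$, and $f_\Gamma$ is the alternating bilinear form on $V_\Gamma$ with, for $v,w\in\mathcal{V}$, $f_\Gamma(v,w)=1$ if and only if $v\sim w$. For an $\mathbb{F}_2$-space $V$ with basis $\mathcal{V}$, a bilinear form $g:V\times V\to\mathbb{F}_2$ and $\lambda:\mathcal{V}\to R^*$, the algebra $\mathfrak{C}(V,g,\lambda)$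 is the free $R$-module with basis the set $V$, with identity the zero vector $0\in V$ (written $\mathbf{1}$) and $R$-bilinear multiplication given on basis elements $v,w\in V$ by $vw=(-1)^{g(v,w)}\Lambda(v,w)\,(v\oplus w)$, where $\Lambda(v,w)=\prod_{b\in\mathcal{V},\ b^*(v)b^*(w)=1}(-1)^{g(b,b)}\lambda(b)$ and $b^*:V\to\mathbb{F}_2$ is the coordinate functional of $b\in\mathcal{V}$. *)

(* Defs.v *)
From HB Require Import structures.
From mathcomp Require Import all_boot all_algebra.
From mathcomp Require Import finmap.
From mathcomp Require Import boolp.
From mathcomp Require Import xfinmap monalg.

Set Implicit Arguments.
Unset Strict Implicit.
Unset Printing Implicit Defensive.

Import GRing.Theory.
Import Quotient.Exports.

Local Open Scope fset_scope.
Local Open Scope quotient_scope.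
Local Open Scope ring_scope.

(* Being simple and undirected means that the adjacency relation is symmetric
   and irreflexive; the vertex type may be infinite. *)
Record labeledGraph (R : comUnitRingType) := LabeledGraph {
  vertex : choiceType;
  adj : rel vertex;
  label : vertex -> R;
  adj_sym : symmetric adj;
  adj_irrefl : irreflexive adj;
  label_unit : forall v, label v \is a GRing.unit
}.

Section IdealGeneratedBy.
Variables (R : comNzRingType) (A : algType R) (P : A -> Prop).

Inductive ideal_gen : A -> Prop :=
| ideal_gen_rel a : P a -> ideal_gen a
| ideal_gen0 : ideal_gen 0
| ideal_genD a b : ideal_gen a -> ideal_gen b -> ideal_gen (a + b)
| ideal_genMl a b : ideal_gen b -> ideal_gen (a * b)
| ideal_genMr a b : ideal_gen a -> ideal_gen (a * b).

Definition ideal_pred : {pred A} := fun a => `[< ideal_gen a >].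

Fact ideal_pred_zmod_closed : zmod_closed ideal_pred.
Proof.
split=> [|a b /asboolP Ia /asboolP Ib]; apply/asboolP; first exact: ideal_gen0.
by apply: ideal_genD => //; rewrite -mulN1r; apply: ideal_genMl.
Qed.

HB.instance Definition _ :=
  GRing.isZmodClosed.Build A ideal_pred ideal_pred_zmod_closed.

(* The quotient of A by the two-sided ideal generated by P. It may be the zero
   ring for some P, which is why it is a pzRingType and an lmodType but not an
   algType: the latter requires 1 != 0. *)
Definition quot_alg : Type := @Quotient.quot A ideal_pred.

HB.instance Definition _ := GRing.Zmodule.on quot_alg.

Definition qpi (a : A) : quot_alg := \pi_(@Quotient.quot A ideal_pred) a.
Definition qrepr (x : quot_alg) : A := repr (x : @Quotient.quot A ideal_pred).

Definition qone : quot_alg := qpi 1.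
Definition qmul (x y : quot_alg) : quot_alg := qpi (qrepr x * qrepr y).
Definition qscale (c : R) (x : quot_alg) : quot_alg := qpi (c *: qrepr x).

Lemma qreprK : cancel qrepr qpi. Proof. exact: reprK. Qed.

Lemma qpi_eq a b : qpi a = qpi b <-> ideal_gen (a - b).
Proof.
split=> [/eqP|Iab].
  by rewrite /qpi -Quotient.idealrBE => /asboolP.
by apply/eqP; rewrite /qpi -Quotient.idealrBE; apply/asboolP.
Qed.

Lemma qpiD a b : qpi (a + b) = qpi a + qpi b.
Proof. exact: (@Quotient.pi_add A ideal_pred a b). Qed.

Lemma qpiM a b : qpi (a * b) = qmul (qpi a) (qpi b).
Proof.
apply/qpi_eq.
have [Ia Ib] : ideal_gen (a - qrepr (qpi a)) /\ ideal_gen (b - qrepr (qpi b)).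
  by split; apply/qpi_eq; rewrite qreprK.
set a' := qrepr (qpi a) in Ia *; set b' := qrepr (qpi b) in Ib *.
have -> : a * b - a' * b' = a * (b - b') + (a - a') * b'.
  by rewrite mulrBr mulrBl addrA subrK.
by apply: ideal_genD; [apply: ideal_genMl | apply: ideal_genMr].
Qed.

Lemma qpiZ c a : qpi (c *: a) = qscale c (qpi a).
Proof.
apply/qpi_eq; rewrite -scalerBr -mulr_algl.
by apply: ideal_genMl; apply/qpi_eq; rewrite qreprK.
Qed.

Fact qmulA : associative qmul.
Proof.
by move=> x y z; rewrite -[x]qreprK -[y]qreprK -[z]qreprK -!qpiM mulrA.
Qed.

Fact qmul1r : left_id qone qmul.
Proof. by move=> x; rewrite -[x]qreprK -qpiM mul1r. Qed.

Fact qmulr1 : right_id qone qmul.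
Proof. by move=> x; rewrite -[x]qreprK -qpiM mulr1. Qed.

Fact qmulDl : left_distributive qmul +%R.
Proof.
move=> x y z; rewrite -[x]qreprK -[y]qreprK -[z]qreprK.
by rewrite -!(qpiD, qpiM) mulrDl.
Qed.

Fact qmulDr : right_distributive qmul +%R.
Proof.
move=> x y z; rewrite -[x]qreprK -[y]qreprK -[z]qreprK.
by rewrite -!(qpiD, qpiM) mulrDr.
Qed.

HB.instance Definition _ := GRing.Zmodule_isPzRing.Build quot_alg
  qmulA qmul1r qmulr1 qmulDl qmulDr.

Fact qscalerA c d x : qscale c (qscale d x) = qscale (c * d) x.
Proof. by rewrite -[x]qreprK -!qpiZ scalerA. Qed.

Fact qscale1r : left_id 1 qscale.
Proof. by move=> x; rewrite -[x]qreprK -qpiZ scale1r. Qed.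

Fact qscalerDr : right_distributive qscale +%R.
Proof.
by move=> c x y; rewrite -[x]qreprK -[y]qreprK -!(qpiD, qpiZ) scalerDr.
Qed.

Fact qscalerDl x : {morph qscale^~ x : c d / c + d}.
Proof. by move=> c d; rewrite -[x]qreprK -!(qpiD, qpiZ) scalerDl. Qed.

HB.instance Definition _ := GRing.Zmodule_isLmodule.Build R quot_alg
  qscalerA qscale1r qscalerDr qscalerDl.

Lemma quot_scalerAl c (x y : quot_alg) : c *: (x * y) = (c *: x) * y.
Proof.
change (qscale c (qmul x y) = qmul (qscale c x) y).
by rewrite -[x]qreprK -[y]qreprK -!(qpiM, qpiZ) scalerAl.
Qed.

Lemma quot_scalerAr c (x y : quot_alg) : c *: (x * y) = x * (c *: y).
Proof.
change (qscale c (qmul x y) = qmul x (qscale c y)).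
by rewrite -[x]qreprK -[y]qreprK -!(qpiM, qpiZ) scalerAr.
Qed.

End IdealGeneratedBy.

Lemma scale_malgU (R : comNzRingType) (K : choiceType) (c a : R) (k : K) :
  c *: << a *g k >> = << c * a *g k >>.
Proof. by apply/malgP => l; rewrite mcoeffZ !mcoeffU mulrnAr. Qed.

(* The free associative unital R-algebra on T: the monoid algebra of the free
   monoid on T. *)
Section FreeAlgebra.
Variables (R : comNzRingType) (T : choiceType).

Definition free_alg : Type := {malg R[{fmonom T}]}.

HB.instance Definition _ := GRing.Lalgebra.on free_alg.

Fact free_alg_scalerAr (c : R) (x y : free_alg) : c *: (x * y) = x * (c *: y).
Proof.
have cE (z : {malg R[{fmonom T}]}) : c *: z = z * << c *g mone >>.
  rewrite malgM_def fgmulgU {1}[z]monalgE scaler_sumr.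
  by apply: eq_bigr => k _; rewrite mulm1 [z@_k * c]mulrC scale_malgU.
by rewrite [LHS]cE [in RHS]cE mulrA.
Qed.

HB.instance Definition _ :=
  GRing.Lalgebra_isAlgebra.Build R free_alg free_alg_scalerAr.

Definition free_gen (v : T) : free_alg := << fmu v >>.

End FreeAlgebra.

Section CliffordGraphAlgebra.
Variables (R : comUnitRingType) (G : labeledGraph R).

Local Notation "''X_' v" := (free_gen R v).

Inductive clifford_rel : free_alg R (vertex G) -> Prop :=
| clifford_rel_sq v : clifford_rel ('X_v * 'X_v - (label v)%:A)
| clifford_rel_adj v w : adj v w -> clifford_rel ('X_v * 'X_w + 'X_w * 'X_v)
| clifford_rel_nonadj v w :
    ~~ adj v w -> clifford_rel ('X_v * 'X_w - 'X_w * 'X_v).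

Definition clifford_graph : Type := quot_alg clifford_rel.

HB.instance Definition _ := GRing.PzRing.on clifford_graph.
HB.instance Definition _ := GRing.Lmodule.on clifford_graph.

End CliffordGraphAlgebra.

(* The F_2-vector space with basis T: finitely supported functions T -> F_2.
   The basis vector of b is << b >> and its coordinate functional is mcoeff b,
   written v@_b. *)
Notation F2space T := {malg 'F_2[T]}.

Section GraphForm.
Variables (R : comUnitRingType) (G : labeledGraph R).
Local Notation V := (F2space (vertex G)).

Definition graph_form (x y : V) : 'F_2 :=
  \sum_(v <- msupp x) \sum_(w <- msupp y) x@_v * y@_w * (adj v w)%:R.

Lemma graph_formEw (d1 d2 : {fset vertex G}) (x y : V) :
  msupp x `<=` d1 -> msupp y `<=` d2 ->
  graph_form x y = \sum_(v <- d1) \sum_(w <- d2) x@_v * y@_w * (adj v w)%:R.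
Proof.
move=> le1 le2; rewrite /graph_form (big_fset_incl _ le1) /=; last first.
  by move=> v _ /mcoeff_outdom xv; rewrite big1 // => w _; rewrite xv !mul0r.
apply: eq_bigr => v _; apply: big_fset_incl => // w _ /mcoeff_outdom ->.
by rewrite mulr0 mul0r.
Qed.

Lemma graph_formU v w : graph_form << v >> << w >> = (adj v w)%:R.
Proof.
by rewrite (graph_formEw msuppU_le msuppU_le) !big_seq_fset1 !mcoeffUU !mul1r.
Qed.

Lemma graph_formC x y : graph_form x y = graph_form y x.
Proof.
rewrite /graph_form exchange_big /=; apply: eq_bigr => v _.
by apply: eq_bigr => w _; rewrite [x@_w * _]mulrC adj_sym.
Qed.

Fact graph_form_linear x : linear_for *%R (graph_form x).
Proof.
move=> c y z; set d := msupp (c *: y + z) `|` (msupp y `|` msupp z).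
have sd : msupp (c *: y + z) `<=` d by exact: fsubsetUl.
have yd : msupp y `<=` d by rewrite /d fsetUA fsetUAC fsubsetUr.
have zd : msupp z `<=` d by rewrite /d fsetUA fsubsetUr.
have xx := fsubset_refl (msupp x).
rewrite (graph_formEw xx sd) (graph_formEw xx yd) (graph_formEw xx zd).
rewrite mulr_sumr -big_split /=; apply: eq_bigr => v _.
rewrite mulr_sumr -big_split /=; apply: eq_bigr => w _.
by rewrite mcoeffD mcoeffZ mulrDr mulrDl !mulrA [x@_v * c]mulrC.
Qed.

Fact graph_form_bilinear : bilinear_for *%R *%R graph_form.
Proof.
split=> x; last exact: graph_form_linear.
by move=> c y z; rewrite ![graph_form _ x]graph_formC graph_form_linear.
Qed.

HB.instance Definition _ :=
  bilinear_isBilinear.Build 'F_2 V V 'F_2 *%R *%R graph_form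
    graph_form_bilinear.

Lemma graph_form_alternating x : graph_form x x = 0.
Proof.
pose q y := graph_form y y.
have qD : {morph q : y z / y + z}.
  move=> y z; rewrite /q linearDr !linearDl /=.
  rewrite -addrA [graph_form z y + _]addrA [graph_form z y]graph_formC.
  by rewrite -mulr2n -mulr_natr pchar_Zp // mulr0 add0r.
have q0 : q 0 = 0 by rewrite /q linear0r.
rewrite -/(q x) [x]monalgE (big_morph q qD q0) big1 // => v _.
rewrite /q (graph_formEw msuppU_le msuppU_le) !big_seq_fset1.
by rewrite adj_irrefl mulr0.
Qed.

End GraphForm.

(* The twisted product on a free module R[V] attached to k : V -> V -> R; it is
   only used to transfer the algebra laws to twisted_alg below. *)
Section TwistedProduct.
Variables (R : comNzRingType) (V : zmodType) (k : V -> V -> R).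

Definition gtwist_one : {malg R[V]} := << 0 >>.

Definition gtwist_mul (x y : {malg R[V]}) : {malg R[V]} :=
  \sum_(v <- msupp x) \sum_(w <- msupp y) << x@_v * y@_w * k v w *g v + w >>.

Lemma gtwist_mulw (d1 d2 : {fset V}) (x y : {malg R[V]}) :
  msupp x `<=` d1 -> msupp y `<=` d2 ->
  gtwist_mul x y =
    \sum_(v <- d1) \sum_(w <- d2) << x@_v * y@_w * k v w *g v + w >>.
Proof.
move=> le1 le2; rewrite /gtwist_mul (big_fset_incl _ le1) /=; last first.
  move=> v _ /mcoeff_outdom xv; rewrite big1 // => w _.
  by rewrite xv !mul0r monalgU0.
apply: eq_bigr => v _; apply: big_fset_incl => // w _ /mcoeff_outdom ->.
by rewrite mulr0 mul0r monalgU0.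
Qed.

Lemma gtwist_mulUU a b v w :
  gtwist_mul << a *g v >> << b *g w >> = << a * b * k v w *g v + w >>.
Proof. by rewrite (gtwist_mulw msuppU_le msuppU_le) !big_seq_fset1 !mcoeffUU. Qed.

Lemma gtwist_mulDl : left_distributive gtwist_mul +%R.
Proof.
move=> x y z; set d := msupp x `|` msupp y.
have xd : msupp x `<=` d by exact: fsubsetUl.
have yd : msupp y `<=` d by exact: fsubsetUr.
have zz := fsubset_refl (msupp z).
rewrite (gtwist_mulw (msuppD_le x y) zz) (gtwist_mulw xd zz).
rewrite (gtwist_mulw yd zz) -big_split /=; apply: eq_bigr => v _.
rewrite -big_split /=; apply: eq_bigr => w _.
by rewrite mcoeffD !mulrDl monalgUD.
Qed.

Lemma gtwist_mulDr : right_distributive gtwist_mul +%R.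
Proof.
move=> z x y; set d := msupp x `|` msupp y.
have xd : msupp x `<=` d by exact: fsubsetUl.
have yd : msupp y `<=` d by exact: fsubsetUr.
have zz := fsubset_refl (msupp z).
rewrite (gtwist_mulw zz (msuppD_le x y)) (gtwist_mulw zz xd).
rewrite (gtwist_mulw zz yd) -big_split /=; apply: eq_bigr => v _.
rewrite -big_split /=; apply: eq_bigr => w _.
by rewrite mcoeffD !(mulrDl, mulrDr) monalgUD.
Qed.

Lemma gtwist_mul0r : left_zero 0 gtwist_mul.
Proof. by move=> x; rewrite /gtwist_mul msupp0 big_seq_fset0. Qed.

Lemma gtwist_mulr0 : right_zero 0 gtwist_mul.
Proof.
move=> x; rewrite /gtwist_mul big1 // => v _.
by rewrite msupp0 big_seq_fset0.
Qed.

Lemma gtwist_ind (P : {malg R[V]} -> Prop) :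
    P 0 -> (forall x y, P x -> P y -> P (x + y)) ->
    (forall a v, P << a *g v >>) ->
  forall x, P x.
Proof.
by move=> P0 PD PU x; rewrite [x]monalgE; apply: (big_ind P) => // v _.
Qed.

Lemma gtwist_scalerAl c x y : c *: gtwist_mul x y = gtwist_mul (c *: x) y.
Proof.
rewrite (gtwist_mulw (msuppZ_le c x) (fsubset_refl _)) scaler_sumr.
apply: eq_bigr => v _; rewrite scaler_sumr; apply: eq_bigr => w _.
by rewrite scale_malgU mcoeffZ !mulrA.
Qed.

Lemma gtwist_scalerAr c x y : c *: gtwist_mul x y = gtwist_mul x (c *: y).
Proof.
rewrite (gtwist_mulw (fsubset_refl _) (msuppZ_le c y)) scaler_sumr.
apply: eq_bigr => v _; rewrite scaler_sumr; apply: eq_bigr => w _.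
by rewrite scale_malgU mcoeffZ !mulrA [x@_v * c]mulrC.
Qed.

Hypothesis kA : forall u v w, k u v * k (u + v) w = k v w * k u (v + w).
Hypothesis k0l : forall v, k 0 v = 1.
Hypothesis k0r : forall v, k v 0 = 1.

Lemma gtwist_mulA : associative gtwist_mul.
Proof.
move: gtwist_mulDl gtwist_mulDr gtwist_mul0r gtwist_mulr0 gtwist_mulUU.
move: gtwist_mul => m mDl mDr m0r mr0 mUU x y z.
elim/gtwist_ind: x => [|x x' IHx IHx'|a u]; first by rewrite !m0r.
  by rewrite !mDl IHx IHx'.
move Ep : << a *g u >> => p.
elim/gtwist_ind: y => [|y y' IHy IHy'|b v]; first by rewrite m0r !mr0 m0r.
  by rewrite mDl !mDr mDl IHy IHy'.
move Eq : << b *g v >> => q.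
elim/gtwist_ind: z => [|z z' IHz IHz'|c w]; first by rewrite !mr0.
  by rewrite !mDr IHz IHz'.
move Er : << c *g w >> => r.
have -> : m p q = << a * b * k u v *g u + v >>.
  by rewrite -Ep -Eq; exact: mUU.
have -> : m q r = << b * c * k v w *g v + w >>.
  by rewrite -Eq -Er; exact: mUU.
rewrite -{}Ep -{}Er; apply: etrans (mUU _ _ _ _) _.
apply: etrans (esym (mUU _ _ _ _)); rewrite (addrA u v w).
congr << _ *g _ >>; move: (kA u v w).
move: (k u v) (k (u + v) w) (k v w) (k u (v + w)).
move=> k1 k2 k3 k4 k12.
by rewrite !mulrA -[_ * k3 * k4]mulrA -k12 !mulrA [a * b * k1 * c]mulrAC.
Qed.

Lemma gtwist_mul1r : left_id gtwist_one gtwist_mul.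
Proof.
elim/gtwist_ind=> [|x y IHx IHy|a v]; first exact: gtwist_mulr0.
  by rewrite (gtwist_mulDr _ x y) IHx IHy.
rewrite gtwist_mulUU.
by rewrite k0l !(mul1r, mulr1) add0r.
Qed.

Lemma gtwist_mulr1 : right_id gtwist_one gtwist_mul.
Proof.
elim/gtwist_ind=> [|x y IHx IHy|a v]; first exact: gtwist_mul0r.
  by rewrite (gtwist_mulDl x y) IHx IHy.
rewrite gtwist_mulUU.
by rewrite k0r !(mul1r, mulr1) addr0.
Qed.

End TwistedProduct.

(* The free R-module on the set V = F2space T; g and lam only enter through the
   multiplication defined on it below. *)
Definition twisted_alg (R : comNzRingType) (T : choiceType)
  (g : {biscalar F2space T}) (lam : T -> R) : Type := {malg R[F2space T]}.
Arguments twisted_alg {R T} g lam.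

Section TwistedAlgebra.
Variables (R : comNzRingType) (T : choiceType).
Variables (g : {biscalar F2space T}) (lam : T -> R).
Local Notation V := (F2space T).

Definition F2sign (c : 'F_2) : R := (-1) ^+ (c : nat).

(* Every b with v@_b * w@_b = 1 lies in the finite support of v. *)
Definition Lambda (v w : V) : R :=
  \prod_(b <- msupp v | v@_b * w@_b == 1)
    (F2sign (g << b >> << b >>) * lam b).

Local Notation twisted_alg := (twisted_alg g lam).

HB.instance Definition _ := GRing.Lmodule.on twisted_alg.

Definition twisted_one : twisted_alg := << 0 >>.

(* The bilinear extension of v w = (-1)^g(v,w) Lambda(v,w) (v + w). *)
Definition twisted_mul (x y : twisted_alg) : twisted_alg :=
  \sum_(v <- msupp x) \sum_(w <- msupp y)
    << x@_v * y@_w * (F2sign (g v w) * Lambda v w) *g v + w >>.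

Local Notation coef v w := (F2sign (g v w) * Lambda v w).

Lemma F2signD c d : F2sign (c + d) = F2sign c * F2sign d.
Proof. by rewrite /F2sign /= modn2 signr_odd exprD. Qed.

Lemma LambdaEw (d : {fset T}) v w : msupp v `<=` d ->
  Lambda v w =
    \prod_(b <- d) (F2sign (g << b >> << b >>) * lam b) ^+ (v@_b * w@_b == 1).
Proof.
move=> le; rewrite /Lambda big_mkcond /= (big_fset_incl _ le) /=.
  by apply: eq_bigr => b _; case: (_ == _).
by move=> b _ /mcoeff_outdom ->; rewrite mul0r.
Qed.

Lemma Lambda0l w : Lambda 0 w = 1.
Proof. by rewrite /Lambda big1_seq // => b; rewrite msupp0 inE andbF. Qed.

Lemma Lambda0r v : Lambda v 0 = 1.
Proof. by rewrite /Lambda big1 // => b; rewrite mcoeff0 mulr0. Qed.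

Lemma Lambda_cocycle u v w :
  Lambda u v * Lambda (u + v) w = Lambda v w * Lambda u (v + w).
Proof.
set d := msupp u `|` msupp v.
have ud : msupp u `<=` d by exact: fsubsetUl.
have vd : msupp v `<=` d by exact: fsubsetUr.
rewrite !(LambdaEw _ ud) (LambdaEw _ vd) (LambdaEw _ (msuppD_le u v)).
rewrite -!big_split /=; apply: eq_bigr => b _; rewrite !mcoeffD -!exprD.
congr (_ ^+ _).
by move: (u@_b) (v@_b) (w@_b) => [[|[|//]] ?] [[|[|//]] ?] [[|[|//]] ?].
Qed.

Lemma coef_cocycle u v w :
  coef u v * coef (u + v) w = coef v w * coef u (v + w).
Proof.
rewrite mulrACA [RHS]mulrACA Lambda_cocycle linearDr linearDl /= !F2signD.
by congr (_ * _); rewrite mulrA mulrC.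
Qed.

Lemma coef0l v : coef 0 v = 1.
Proof. by rewrite linear0l Lambda0l mulr1. Qed.

Lemma coef0r v : coef v 0 = 1.
Proof. by rewrite linear0r Lambda0r mulr1. Qed.

Fact twisted_mulA : associative twisted_mul.
Proof. exact/gtwist_mulA/coef_cocycle. Qed.

Fact twisted_mul1r : left_id twisted_one twisted_mul.
Proof. exact/gtwist_mul1r/coef0l. Qed.

Fact twisted_mulr1 : right_id twisted_one twisted_mul.
Proof. exact/gtwist_mulr1/coef0r. Qed.

Fact twisted_mulDl : left_distributive twisted_mul +%R.
Proof. exact: gtwist_mulDl. Qed.

Fact twisted_mulDr : right_distributive twisted_mul +%R.
Proof. exact: gtwist_mulDr. Qed.

Fact twisted_oner_neq0 : twisted_one != 0.
Proof. by rewrite monalgU_eq0 oner_eq0. Qed.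

HB.instance Definition _ := GRing.Zmodule_isNzRing.Build twisted_alg
  twisted_mulA twisted_mul1r twisted_mulr1 twisted_mulDl twisted_mulDr
  twisted_oner_neq0.

Fact twisted_scalerAl (c : R) (x y : twisted_alg) : c *: (x * y) = (c *: x) * y.
Proof. exact: gtwist_scalerAl. Qed.

Fact twisted_scalerAr (c : R) (x y : twisted_alg) : c *: (x * y) = x * (c *: y).
Proof. exact: gtwist_scalerAr. Qed.

HB.instance Definition _ :=
  GRing.LSemiModule_isLSemiAlgebra.Build R twisted_alg twisted_scalerAl.
HB.instance Definition _ :=
  GRing.LSemiAlgebra_isSemiAlgebra.Build R twisted_alg twisted_scalerAr.

Lemma twisted_algM v w :
  (<< v >> : twisted_alg) * << w >> = << coef v w *g v + w >>.
Proof. by rewrite [LHS]gtwist_mulUU !mul1r. Qed.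

End TwistedAlgebra.

(* Main.v *)
Require Import Defs.
From HB Require Import structures.
From mathcomp Require Import all_boot all_algebra.
From mathcomp Require Import finmap.
From mathcomp Require Import xfinmap monalg.

Set Implicit Arguments.
Unset Strict Implicit.
Unset Printing Implicit Defensive.

Import GRing.Theory.

Local Open Scope ring_scope.

(** Sending each vertex v to the basis element [<< v >>] of the twisted algebra
    respects the defining relations of the Clifford graph algebra C(Gamma).
    Indeed [<< v >>] squares to lambda(v), because the sign (-1)^g(v,v) of the
    product cancels the one inside Lambda(v,v); and for v != w the products
    [<< v >> * << w >>] and [<< w >> * << v >>] are +-[<< v + w >>], with ratio
    (-1)^(g(v,w) + g(w,v)) = (-1)^f(v,w), which is what adjacency prescribes
    ([twisted_gen_sq], [twisted_genC]). Hence there is an algebra morphism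
    [to_twisted].

    A word v_1 ... v_n is sent to a unit times the basis element at
    v_1 + ... + v_n ([to_twisted_word]); the unit is a product of signs and
    labels. Taking for the letters the support of an arbitrary u in V reaches
    every basis element up to a unit, so the linear map [of_twisted], which
    sends the basis element at u to the suitably rescaled word on the support
    of u, is a right inverse of [to_twisted].

    It is also a left inverse, because C(Gamma) is no larger than expected: the
    relations allow one to permute the letters of a word at the cost of a
    scalar and to replace a repeated letter by its label, so that each word is
    a multiple of the word on the support of the sum of its letters
    ([clifford_word_reduce]). Those words thus span C(Gamma), and on them
    [to_twisted] followed by [of_twisted] is the identity. *)

(** * Linear maps out of a free module *)

Section LinearExtension.
Variables (R : nzRingType) (K : choiceType) (M : lmodType R) (h : K -> M).

Definition malg_ext (x : {malg R[K]}) : M := \sum_(k <- msupp x) x@_k *: h k.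

Lemma malg_extEw (d : {fset K}) (x : {malg R[K]}) :
  fsubset (msupp x) d -> malg_ext x = \sum_(k <- d) x@_k *: h k.
Proof.
move=> le; rewrite /malg_ext (big_fset_incl _ le) //=.
by move=> k _ /mcoeff_outdom ->; rewrite scale0r.
Qed.

Lemma malg_extU c k : malg_ext << c *g k >> = c *: h k.
Proof. by rewrite (malg_extEw msuppU_le) big_seq_fset1 mcoeffUU. Qed.

Fact malg_ext_linear : linear malg_ext.
Proof.
move=> c x y; set d := fsetU (msupp (c *: x + y)) (fsetU (msupp x) (msupp y)).
have sd : fsubset (msupp (c *: x + y)) d by exact: fsubsetUl.
have xd : fsubset (msupp x) d by rewrite /d fsetUA fsetUAC fsubsetUr.
have yd : fsubset (msupp y) d by rewrite /d fsetUA fsubsetUr.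
rewrite (malg_extEw sd) (malg_extEw xd) (malg_extEw yd).
rewrite scaler_sumr -big_split /=; apply: eq_bigr => k _.
by rewrite mcoeffD mcoeffZ scalerDl scalerA.
Qed.

HB.instance Definition _ :=
  GRing.isLinear.Build R {malg R[K]} M *:%R malg_ext malg_ext_linear.

Lemma malg_linear_eq (f1 f2 : {linear {malg R[K]} -> M}) :
  (forall k, f1 << k >> = f2 << k >>) -> f1 =1 f2.
Proof.
move=> f12 x; rewrite [x]monalgE !linear_sum; apply: eq_bigr => k _.
have -> : << x@_k *g k >> = x@_k *: << k >> :> {malg R[K]}.
  by apply/malgP => l; rewrite mcoeffZ !mcoeffU mulrnAr mulr1.
by rewrite !linearZ f12.
Qed.

End LinearExtension.

(** * Universal properties of the free algebra and of quotients *)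

Section FreeLift.
Variables (R : comNzRingType) (T : choiceType) (A : algType R) (f : T -> A).

Definition monom_eval (m : {fmonom T}) : A := \prod_(v <- m) f v.

Fact monom_eval_mmorphism : mmorphism monom_eval.
Proof.
by split=> [m n|]; rewrite /monom_eval ?fmM ?big_cat // fm1 big_nil.
Qed.

HB.instance Definition _ :=
  isMultiplicative.Build {fmonom T} A monom_eval monom_eval_mmorphism.

Definition free_lift : free_alg R T -> A := mmap (in_alg A) monom_eval.

Fact free_lift_linear : linear free_lift.
Proof.
move=> c x y; rewrite /free_lift.
by rewrite [LHS]raddfD /= [X in X + _]mmapZ mulr_algl.
Qed.

(** The evaluation at a noncommutative target is multiplicative because the
    coefficients land in the centre of [A]. *)
Fact free_lift_monoid_morphism : monoid_morphism free_lift.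
Proof.
have cA (x : {malg R[{fmonom T}]}) (m m' : {fmonom T}) :
    GRing.comm (in_alg A x@_m) (monom_eval m').
  by rewrite /GRing.comm /= mulr_algl mulr_algr.
by split; [exact: mmap1 | exact: (commr_mmap_is_multiplicative cA).1].
Qed.

HB.instance Definition _ :=
  GRing.isLinear.Build R (free_alg R T) A *:%R free_lift free_lift_linear.
HB.instance Definition _ :=
  GRing.isMonoidMorphism.Build (free_alg R T) A free_lift
    free_lift_monoid_morphism.

Lemma free_lift_gen v : free_lift (free_gen R v) = f v.
Proof.
rewrite [LHS](@mmapU _ _ _ (in_alg A)) /= scale1r mul1r.
by rewrite /monom_eval fmuE /= big_seq1.
Qed.

End FreeLift.

(** The monomials of the monoid algebra are the products of generators, so that
    linear maps out of the free algebra are determined by words. *)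
Lemma free_monomE (R : comNzRingType) (T : choiceType) (m : {fmonom T}) :
  (<< m >> : free_alg R T) = \prod_(v <- m) free_gen R v.
Proof.
case: m => s /=; elim: s => [|v s IHs].
  by rewrite big_nil -fmoneE.
rewrite big_cons -IHs /free_gen; apply: etrans (esym (fgmulUU _ _ _ _)).
by rewrite mulr1; congr << _ *g _ >>; rewrite fmuE [RHS]fmmulE.
Qed.

Section QuotientLift.
Variables (R : comNzRingType) (A B : algType R) (P : A -> Prop).
Variables (h : {lrmorphism A -> B}).
Hypothesis hP : forall a, P a -> h a = 0.

(** The kernel of [h] is a two-sided ideal, hence contains the ideal generated by
    any relations it contains. *)
Lemma ideal_gen_lift a : ideal_gen P a -> h a = 0.
Proof.
elim=> [|||b c _|b c _] //; first exact: rmorph0.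
- by move=> b c _ hb _ hc; rewrite raddfD /= hb hc addr0.
- by rewrite rmorphM /= => ->; rewrite mulr0.
- by rewrite rmorphM /= => ->; rewrite mul0r.
Qed.

Definition quot_lift (x : quot_alg P) : B := h (qrepr x).

Lemma quot_liftE a : quot_lift (qpi P a) = h a.
Proof.
apply/eqP; rewrite -subr_eq0 -rmorphB; apply/eqP/ideal_gen_lift.
by apply/qpi_eq; rewrite qreprK.
Qed.

Fact quot_lift_linear : linear quot_lift.
Proof.
move=> c x y; rewrite -[x]qreprK -[y]qreprK.
by rewrite -[c *: _]qpiZ -qpiD !quot_liftE linearP.
Qed.

Lemma quot_lift_monoid_morphism : monoid_morphism quot_lift.
Proof.
split=> [|x y]; first by rewrite quot_liftE rmorph1.
by rewrite -[x]qreprK -[y]qreprK -[_ * _]qpiM !quot_liftE rmorphM.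
Qed.

End QuotientLift.

(** * Supports in the space V over F_2 *)

Section Support.
Variable T : choiceType.
Local Notation V := (F2space T).

Definition word_sum (s : seq T) : V := \sum_(v <- s) << v >>.

Lemma F2_neq0 (a : 'F_2) : a != 0 -> a = 1.
Proof. by case: a => [[|[|//]] ia] // _; apply: val_inj. Qed.

Lemma F2space_addvv (u : V) : u + u = 0.
Proof.
by apply/malgP => k; rewrite mcoeffD mcoeff0 -mulr2n -mulr_natr pchar_Zp ?mulr0.
Qed.

Lemma word_sum_msupp (u : V) : word_sum (msupp u) = u.
Proof.
rewrite [RHS]monalgE; apply: eq_big_seq => v; rewrite -mcoeff_neq0.
by move/F2_neq0 ->.
Qed.

(** In characteristic 2, adding a basis vector toggles it in the support. The two
    lemmas give the list of letters before and after, up to order. *)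
Lemma perm_msupp_addU (u : V) v :
  v \in msupp u -> perm_eq (msupp u) (v :: msupp (<< v >> + u)).
Proof.
move=> vu; have uv : u@_v = 1 by apply: F2_neq0; rewrite mcoeff_neq0.
have v0 : (<< v >> + u)@_v = 0.
  by rewrite mcoeffD mcoeffUU uv -mulr2n -mulr_natr pchar_Zp ?mulr0.
apply: uniq_perm; rewrite ?fset_uniq //=.
  by rewrite fset_uniq -mcoeff_eq0 v0 eqxx.
move=> w; rewrite inE; have [->|wv] := eqVneq w v; first by rewrite vu.
by rewrite -!mcoeff_neq0 mcoeffD mcoeffU [v == w]eq_sym (negPf wv) add0r.
Qed.

Lemma perm_msupp_addU_notin (u : V) v :
  v \notin msupp u -> perm_eq (v :: msupp u) (msupp (<< v >> + u)).
Proof.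
(* The previous lemma for v + u, as adding v twice gives back u. *)
move=> vu; have {1}-> : u = << v >> + (<< v >> + u).
  by rewrite addrA F2space_addvv add0r.
rewrite perm_sym; apply: perm_msupp_addU.
move: vu; rewrite -mcoeff_eq0 -mcoeff_neq0 mcoeffD mcoeffUU => /eqP ->.
by rewrite addr0.
Qed.

End Support.

(** * Words in the Clifford graph algebra *)

Section CliffordWords.
Variables (R : comUnitRingType) (G : labeledGraph R).
Local Notation C := (clifford_graph G).

Definition clifford_gen (v : vertex G) : C :=
  qpi (@clifford_rel R G) (free_gen R v).

Definition clifford_word (s : seq (vertex G)) : C :=
  \prod_(v <- s) clifford_gen v.

Local Notation x_ := clifford_gen.
Local Notation w_ := clifford_word.

Lemma clifford_word_cons v s : w_ (v :: s) = x_ v * w_ s.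
Proof. exact: big_cons. Qed.

Lemma clifford_word_cat s t : w_ (s ++ t) = w_ s * w_ t.
Proof. exact: big_cat. Qed.

Lemma clifford_scaleAl c (x y : C) : (c *: x) * y = c *: (x * y).
Proof. by rewrite [RHS]quot_scalerAl. Qed.

Lemma clifford_scaleAr c (x y : C) : x * (c *: y) = c *: (x * y).
Proof. by rewrite [RHS]quot_scalerAr. Qed.

Lemma clifford_gen_sq v : x_ v * x_ v = label v *: (1 : C).
Proof.
rewrite -[LHS]qpiM -[RHS]qpiZ; apply/qpi_eq/ideal_gen_rel.
exact: clifford_rel_sq.
Qed.

Lemma clifford_gen_anticomm v w : adj v w -> x_ v * x_ w = - (x_ w * x_ v).
Proof.
move=> vw; apply/eqP; rewrite -subr_eq0 opprK; apply/eqP.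
rewrite -[x_ v * _]qpiM -[x_ w * _]qpiM -qpiD.
have -> : 0 = qpi (@clifford_rel R G) 0 by apply: esym; exact: raddf0.
apply/qpi_eq; rewrite subr0; apply/ideal_gen_rel; exact: clifford_rel_adj.
Qed.

Lemma clifford_gen_comm v w : ~~ adj v w -> x_ v * x_ w = x_ w * x_ v.
Proof.
move=> vw; rewrite -[LHS]qpiM -[RHS]qpiM; apply/qpi_eq/ideal_gen_rel.
exact: clifford_rel_nonadj.
Qed.

(** Permuting letters in a word of C(Gamma) produces a sign; only the existence
    of some scalar matters for spanning, and not keeping track of it makes the
    notion stable under products without bookkeeping. *)
Definition commutes_up_to (x y : C) := exists c : R, x * y = c *: (y * x).

Lemma commutes_up_to_word (x : C) s :
  (forall v, v \in s -> commutes_up_to x (x_ v)) -> commutes_up_to x (w_ s).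
Proof.
elim: s => [_|v s IHs cs].
  by exists 1; rewrite /w_ big_nil mulr1 mul1r scale1r.
have [c xv] := cs v (mem_head v s).
have [u us|d xs] := IHs; first by apply: cs; rewrite inE us orbT.
exists (c * d); rewrite clifford_word_cons mulrA xv -scalerA -mulrA.
rewrite -[in RHS]clifford_scaleAr -xs mulrA.
exact: clifford_scaleAl.
Qed.

Lemma clifford_gen_commutes_up_to v w : commutes_up_to (x_ v) (x_ w).
Proof.
have [vw|vw] := boolP (adj v w).
  exists (-1); rewrite scaleN1r; exact: clifford_gen_anticomm.
exists 1; rewrite scale1r; exact: clifford_gen_comm.
Qed.

(** The first letter of [s] is moved to the front of [t] through the letters that
    precede it there, each exchange costing a scalar. *)
Lemma clifford_word_perm s t :
  perm_eq s t -> exists c : R, w_ s = c *: w_ t.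
Proof.
elim: s t => [|v s IHs] t.
  rewrite perm_sym => /perm_nilP ->; exists 1; rewrite scale1r; reflexivity.
move=> st; have vt : v \in t by rewrite -(perm_mem st) mem_head.
have [t1 [t2 [d [et tE]]]] : exists t1 t2 (d : R),
    t = t1 ++ v :: t2 /\ x_ v * w_ t1 = d *: (w_ t1 * x_ v).
  case/splitPr: vt st => t1 t2 _.
  have [|d vt1] := @commutes_up_to_word (x_ v) t1.
    by move=> u _; exact: clifford_gen_commutes_up_to.
  by exists t1, t2, d.
have /IHs [c sE] : perm_eq s (t1 ++ t2).
  by rewrite -(perm_cons v) (perm_trans st) // et -[v :: t2]cat1s perm_catCA.
exists (c * d); rewrite clifford_word_cons sE et -scalerA.
rewrite !clifford_word_cat clifford_word_cons clifford_scaleAr; congr (_ *: _).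
rewrite !mulrA tE; exact: clifford_scaleAl.
Qed.

(** Multiplying by v on the left flips the membership of v in the support: if v
    is new, the word only has to be sorted; if v is already there, bring it to
    the front, where it meets the new v and the square is a label. *)
Lemma clifford_word_reduce s :
  exists c : R, w_ s = c *: w_ (msupp (word_sum s)).
Proof.
elim: s => [|v s [c sE]].
  exists 1; rewrite /word_sum big_nil msupp0 scale1r; reflexivity.
rewrite clifford_word_cons sE clifford_scaleAr.
have -> : word_sum (v :: s) = << v >> + word_sum s by exact: big_cons.
move: (word_sum s) => u; have [vu|vu] := boolP (v \in msupp u).
  have [d ->] := clifford_word_perm (perm_msupp_addU vu).
  exists (c * (d * label v)); rewrite -!scalerA; congr (_ *: _).
  rewrite clifford_word_cons clifford_scaleAr mulrA clifford_gen_sq.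
  rewrite clifford_scaleAl mul1r; reflexivity.
have [d] := clifford_word_perm (perm_msupp_addU_notin vu).
rewrite clifford_word_cons => ->; exists (c * d); exact: scalerA.
Qed.

(** Words span C(Gamma). *)
Lemma clifford_linear_eq (M : lmodType R) (f h : {linear C -> M}) :
  (forall s, f (w_ s) = h (w_ s)) -> f =1 h.
Proof.
move=> fh x; rewrite -[x]qreprK.
pose p : free_alg R (vertex G) -> C := qpi (@clifford_rel R G).
have p_lin : linear p.
  by move=> c a b; apply: etrans (qpiD _ _ _) (congr1 (+%R^~ _) (qpiZ _ _ _)).
pose plM := GRing.isLinear.Build _ _ _ *:%R p p_lin.
pose pL : {linear free_alg R (vertex G) -> C} := HB.pack p plM.
apply: (@malg_linear_eq _ _ _ (f \o pL) (h \o pL)) => m /=.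
have -> // : p << m >> = w_ m.
rewrite free_monomE; apply: big_morph => [a b|]; [exact: qpiM | reflexivity].
Qed.

End CliffordWords.

(** * The isomorphism *)

Section Comparison.
Variables (R : comUnitRingType) (G : labeledGraph R).
Variable g : {biscalar F2space (vertex G)}.
Hypothesis g_form : forall v w : vertex G,
  g << v >> << w >> + g << w >> << v >> = graph_form << v >> << w >>.
Local Notation V := (F2space (vertex G)).
Local Notation lam := (@label R G).
Local Notation B := (twisted_alg g lam).
Local Notation C := (clifford_graph G).
Local Notation sgn := (F2sign R).

Definition twisted_gen (v : vertex G) : B := << << v >> >>.

Definition twisted_coef (u v : V) : R := sgn (g u v) * Lambda g lam u v.

Lemma F2sign_mul_self (a : 'F_2) : sgn a * sgn a = 1.
Proof. by rewrite -expr2 /F2sign sqrr_sign. Qed.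

Lemma F2sign_unit (a : 'F_2) : sgn a \is a GRing.unit.
Proof. by apply/unitrP; exists (sgn a); rewrite F2sign_mul_self. Qed.

Lemma twisted_coef_unit u v : twisted_coef u v \is a GRing.unit.
Proof.
rewrite unitrM F2sign_unit /Lambda /=.
by apply: rpred_prod => b _; rewrite unitrM F2sign_unit label_unit.
Qed.

Lemma Lambda_basis v w :
  Lambda g lam << v >> << w >> =
    if v == w then sgn (g << v >> << v >>) * label v else 1.
Proof.
rewrite (LambdaEw _ _ _ msuppU_le) big_seq_fset1 mcoeffUU mcoeffU mul1r.
by rewrite [w == v]eq_sym; case: (v == w).
Qed.

(** The sign (-1)^g(v,v) of the product and the one in Lambda(v,v) cancel. *)
Lemma twisted_gen_sq v : twisted_gen v * twisted_gen v = (label v)%:A.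
Proof.
rewrite [LHS]twisted_algM Lambda_basis eqxx mulrA F2sign_mul_self mul1r F2space_addvv.
by rewrite -[in LHS](mulr1 (label v)) -scale_malgU.
Qed.

(** For v = w both sides agree since the graph form is alternating; for v != w
    the factor Lambda is 1 and only the signs (-1)^g(v,w) and (-1)^g(w,v)
    remain, whose ratio is given by g(v,w) + g(w,v). *)
Lemma twisted_genC v w :
  twisted_gen v * twisted_gen w =
    sgn (graph_form << v >> << w >>) *: (twisted_gen w * twisted_gen v).
Proof.
rewrite [in LHS]twisted_algM [in RHS]twisted_algM scale_malgU addrC.
congr << _ *g _ >>; rewrite -g_form F2signD !Lambda_basis eq_sym mulrA.
rewrite -[sgn _ * _ * sgn _]mulrA F2sign_mul_self mulr1.
by case: eqP => // ->.
Qed.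

(** Stated for an arbitrary morphism with the right values on generators: the
    relations only involve those values. *)
Lemma twisted_gen_clifford_rel (h : {lrmorphism free_alg R (vertex G) -> B}) :
    (forall v, h (free_gen R v) = twisted_gen v) ->
  forall a, clifford_rel a -> h a = 0.
Proof.
move=> hX a.
have hM v w : h (free_gen R v * free_gen R w) = twisted_gen v * twisted_gen w.
  by apply: etrans (rmorphM h _ _) _; rewrite /= !hX.
have hMB v w b : h (free_gen R v * free_gen R w - b) =
    twisted_gen v * twisted_gen w - h b.
  by apply: etrans (linearB h _ _) _; rewrite /= hM.
case=> [v|v w vw|v w vw].
- rewrite hMB twisted_gen_sq; apply/eqP; rewrite subr_eq0; apply/eqP.
  by rewrite linearZ rmorph1.
- apply: etrans (linearD h _ _) _.
  apply: etrans (congr2 +%R (hM v w) (hM w v)) _.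
  apply/eqP; rewrite addr_eq0; apply/eqP; apply: etrans (twisted_genC v w) _.
  rewrite graph_formU vw /F2sign /= expr1 scaleN1r; reflexivity.
- rewrite hMB hM; apply/eqP; rewrite subr_eq0; apply/eqP.
  apply: etrans (twisted_genC v w) _.
  rewrite graph_formU (negPf vw) /F2sign /= expr0 scale1r; reflexivity.
Qed.

Lemma free_lift_clifford_rel a : clifford_rel a -> free_lift twisted_gen a = 0.
Proof. exact/twisted_gen_clifford_rel/free_lift_gen. Qed.

Definition to_twisted : C -> B := quot_lift (free_lift twisted_gen).

Fact to_twisted_linear : linear to_twisted.
Proof. exact: quot_lift_linear free_lift_clifford_rel. Qed.

HB.instance Definition _ :=
  GRing.isLinear.Build R C B *:%R to_twisted to_twisted_linear.

Lemma to_twisted_monoid_morphism : monoid_morphism to_twisted.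
Proof. exact: quot_lift_monoid_morphism free_lift_clifford_rel. Qed.

Definition to_twisted_map : {linear C -> B} := to_twisted.

Lemma to_twisted_gen v : to_twisted (clifford_gen v) = twisted_gen v.
Proof.
exact: etrans (quot_liftE free_lift_clifford_rel _) (free_lift_gen _ _).
Qed.

(** The scalar by which the product in the twisted algebra of the basis elements
    of a word differs from the basis element at the sum of its letters. *)
Fixpoint word_coef (s : seq (vertex G)) : R :=
  if s is v :: s' then twisted_coef << v >> (word_sum s') * word_coef s' else 1.

Lemma word_coef_unit s : word_coef s \is a GRing.unit.
Proof.
by elim: s => [|v s IHs] /=; rewrite ?unitr1 // unitrM twisted_coef_unit.
Qed.

Lemma to_twisted_word s :
  to_twisted (clifford_word s) = << word_coef s *g word_sum s >>.
Proof.
elim: s => [|v s IHs].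
  rewrite /clifford_word /word_sum !big_nil; exact: to_twisted_monoid_morphism.1.
rewrite clifford_word_cons to_twisted_monoid_morphism.2 IHs.
rewrite to_twisted_gen.
apply: etrans (gtwist_mulUU _ _ _ _ _) _; rewrite /word_sum big_cons mul1r.
by congr << _ *g _ >>; rewrite mulrC.
Qed.

(** Each u in V is represented by the word on its support, in the order in which
    the support is enumerated; the scalar makes the image under [to_twisted]
    exactly the basis element at u. *)
Definition of_twisted : B -> C :=
  malg_ext (fun u => (word_coef (msupp u))^-1 *: clifford_word (msupp u)).

HB.instance Definition _ := GRing.Linear.on of_twisted.

Lemma of_twistedU u :
  of_twisted << u >> = (word_coef (msupp u))^-1 *: clifford_word (msupp u).
Proof. by rewrite [LHS]malg_extU scale1r. Qed.

(** It suffices to look at words. The unknown scalar relating a word to the word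
    on the support of its sum goes through both linear maps unchanged. *)
Lemma to_twistedK : cancel to_twisted of_twisted.
Proof.
apply: (@clifford_linear_eq _ _ _ (of_twisted \o to_twisted) idfun) => s /=.
have [d ->] := clifford_word_reduce s; rewrite !linearZ /=; congr (_ *: _).
rewrite to_twisted_word word_sum_msupp -[word_coef _]mulr1 -scale_malgU.
by rewrite linearZ /= of_twistedU scalerA mulrV ?word_coef_unit // scale1r.
Qed.

Lemma of_twistedK : cancel of_twisted to_twisted.
Proof.
apply: (@malg_linear_eq _ _ _ (to_twisted \o of_twisted) idfun) => u /=.
rewrite of_twistedU linearZ /= to_twisted_word word_sum_msupp.
by rewrite scale_malgU mulVr ?word_coef_unit.
Qed.

End Comparison.

Theorem theorem1p1 (R : comUnitRingType)
    (R_neq : (1 : R) != -1) (R_2reg : GRing.lreg (2 : R))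
    (G : labeledGraph R) (g : {biscalar F2space (vertex G)})
    (g_form : forall v w : vertex G,
      g << v >> << w >> + g << w >> << v >> = graph_form << v >> << w >>) :
  exists2 phi : {linear clifford_graph G -> twisted_alg g (@label R G)},
    monoid_morphism phi & bijective phi.
Proof.
exists (to_twisted_map g_form); first exact: to_twisted_monoid_morphism.
exists (@of_twisted R G g); first exact: (to_twistedK g_form).
exact: (of_twistedK g_form).
Qed.
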